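(* Let $m,n\ge 1$. There is a bijection $\Phi$ from $J([2]\times[m]\times[n])$ to the set of noncrossing set partitions of $[n+m+1]$ into exactly $m+1$ blocks such that $\Phi\circ\mathrm{row}=\mathrm{rot}\circ\Phi$, where $\mathrm{rot}$ is the action on set partitions induced by the cyclic permutation $i\mapsto i+1$ for $i<n+m+1$, $n+m+1\mapsto 1$.
   Context: $[a]$ is the $a$-element chain, $[2]\times[m]\times[n]$ the product poset with componentwise order, and $J(P)$ its set of order ideals. Rowmotion: $\mathrm{row}(I)$ is the order ideal generated by the minimal elements of $P\setminus I$. A set partition of $[N]=\{1,\dots,N\}$ is noncrossing if there are no $a<b<c<d$ with $a,c$ in one block and $b,d$ in a different block. *)

(* Defs.v *)
From HB Require Import structures.
From mathcomp Require Export all_boot all_order.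

Set Implicit Arguments.
Unset Strict Implicit.
Unset Printing Implicit Defensive.

Import Order.TTheory.

Section OrderIdeals.
Local Open Scope order_scope.
Variables (d : Order.disp_t) (P : finPOrderType d).
Implicit Types A I : {set P}.

Definition order_ideal I : bool :=
  [forall x in I, forall y : P, (y <= x) ==> (y \in I)].

Definition order_ideals : {set {set P}} := [set I | order_ideal I].

Definition min_elements A : {set P} :=
  [set x in A | [forall y in A, ~~ (y < x)]].

Definition ideal_generated A : {set P} := [set x | [exists y in A, x <= y]].

Definition rowmotion I : {set P} := ideal_generated (min_elements (~: I)).

End OrderIdeals.

Arguments order_ideals {d} P.

Definition chain_product3 (a b c : nat) : finPOrderType _ :=
  ('I_a *p 'I_b *p 'I_c)%type.

Lemma chain_product3_leE (a b c : nat) (x y : chain_product3 a b c) :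
  (x <= y)%O =
  [&& (x.1.1 <= y.1.1)%N, (x.1.2 <= y.1.2)%N & (x.2 <= y.2)%N].
Proof. by rewrite andbA. Qed.

(* The ground set {1, ..., N} is represented by 'I_N = {0, ..., N-1}. *)
Definition noncrossing (N : nat) (pi : {set {set 'I_N}}) : bool :=
  [forall B in pi, forall C in pi, (B != C) ==>
    ~~ [exists a : 'I_N, exists b : 'I_N, exists c : 'I_N,
        exists d : 'I_N,
          [&& (a < b)%N, (b < c)%N, (c < d)%N,
              a \in B, c \in B, b \in C & d \in C]]].

Definition noncrossing_partitions (N k : nat) : {set {set {set 'I_N}}} :=
  [set pi | [&& partition pi [set: 'I_N], noncrossing pi & #|pi| == k]].

(* ordS i has value (i + 1) mod N. *)
Definition rotate_partition (N : nat) (pi : {set {set 'I_N}}) :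
  {set {set 'I_N}} := [set @ordS N @: B | B : {set 'I_N} in pi].

(* Main.v *)
Require Import Defs.
From mathcomp Require Import all_boot all_order.
From mathcomp Require Import zify.

(** An order ideal [I] of [2] x [m] x [n] is first replaced by its promotion
    slice, whose cell (h,j,k) is read off the iterate row^j(I); the slice
    determines [I], and it is again an order ideal.  With g(h,k) the height of
    its column (h,k), the numbers T(h,k) = m - g(h,k) + h + k form a 2 x n
    increasing tableau with entries below N = n + m + 1, on which rowmotion
    acts as inverse K-promotion: every entry increases by 1, except along a
    sliding path which is present only when N - 1 is an entry.

    The first row of [T] is taken as the set of the non-maximal elements, and
    the second row as the set of the non-minimal elements, of the blocks of a
    noncrossing partition with n arcs, hence N - n = m + 1 blocks.  A slide
    then unlinks N - 1 from its predecessor and links 0 to the former minimum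
    of the block of N - 1, which is what rotation does to the arcs.

    Between [T] and the partition stand two functions: [H z] counts the arcs
    over the gap between z - 1 and z, and [d z] the arcs passing strictly over
    the point z. *)

Set Implicit Arguments.
Unset Strict Implicit.
Unset Printing Implicit Defensive.

(** * Thresholds, arc counts and the linked relation *)

(** For a downward closed [Q] this count is the cutoff: the first index below [n] where [Q] fails,
    or [n] itself. *)
Definition threshold (Q : pred nat) (n : nat) : nat := count Q (iota 0 n).

Lemma thresholdS (Q : pred nat) n : threshold Q n.+1 = threshold Q n + Q n.
Proof. by rewrite /threshold -addn1 iotaD count_cat /= addn0. Qed.

Lemma threshold_le (Q : pred nat) n : threshold Q n <= n.
Proof. by rewrite -{2}(size_iota 0 n) count_size. Qed.

Lemma thresholdP (Q : pred nat) n :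
  (forall i j, i <= j -> j < n -> Q j -> Q i) ->
  forall k, k < n -> Q k = (k < threshold Q n).
Proof.
elim: n => [//|n IH] Qdown k kn; rewrite thresholdS.
have {}IH : forall k, k < n -> Q k = (k < threshold Q n).
  by apply: IH => i j ij jn; apply: Qdown => //; lia.
have tn := threshold_le Q n.
case Qn: (Q n); last first.
  have [kltn|] := ltnP k n; first by rewrite IH // addn0.
  by move=> nk; have -> : k = n by [lia]; rewrite Qn; lia.
rewrite (Qdown k n) //.
case: n kn IH tn Qn Qdown => [|n] kn IH tn Qn Qdown; first lia.
by have := IH n (ltnSn n); rewrite (Qdown n n.+1) //; lia.
Qed.

Lemma threshold_unique (Q : pred nat) n c :
  c <= n -> (forall k, k < n -> Q k = (k < c)) -> threshold Q n = c.
Proof.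
move=> cn Qc.
have QP : forall k, k < n -> Q k = (k < threshold Q n).
  by apply: thresholdP => i j ij jn; rewrite !Qc //; lia.
have tn := threshold_le Q n.
have [tc|ct|//] := ltngtP (threshold Q n) c.
  by have := QP (threshold Q n); rewrite Qc; lia.
by have := QP c; rewrite Qc; lia.
Qed.

(** Point [z] lies between the gaps [z] and [z.+1]. The inequalities say that at most one arc ends
    at [z] and at most one starts there. *)
Definition profile (N : nat) (H d : nat -> nat) : Prop :=
  [/\ H 0 = 0, H N = 0 &
      forall z, z < N -> d z <= H z <= (d z).+1 /\ d z <= H z.+1 <= (d z).+1].

(* Points are linked when they lie at the same depth and the gaps between them
   are all covered by one more arc, the one joining them in their block. *)
Definition linked (H d : nat -> nat) (x y : nat) : bool :=
  (d x == d y) &&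
  all (fun z => d x < H z) (iota (minn x y).+1 (maxn x y - minn x y)).

Lemma linkedP H d x y :
  reflect (d x = d y /\ forall z, minn x y < z <= maxn x y -> d x < H z)
          (linked H d x y).
Proof.
apply: (iffP andP) => [[/eqP dxy /allP Hz]|[dxy Hz]]; split=> //.
- by move=> z zxy; apply: Hz; rewrite mem_iota; lia.
- exact/eqP.
- by apply/allP => z; rewrite mem_iota => zxy; apply: Hz; lia.
Qed.

Lemma linked_refl H d : reflexive (linked H d).
Proof. by move=> x; apply/linkedP; split=> // z; lia. Qed.

Lemma linked_sym H d : symmetric (linked H d).
Proof.
by move=> x y; apply/linkedP/linkedP => -[dxy Hz]; split=> // z zyx;
  rewrite -dxy; apply: Hz; lia.
Qed.

Lemma linked_trans H d : transitive (linked H d).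
Proof.
move=> y x w /linkedP[dxy Hxy] /linkedP[dyw Hyw]; apply/linkedP; split.
  by rewrite dxy.
move=> z zxw; case: (boolP (minn x y < z <= maxn x y)) => [/Hxy //|zxy].
by rewrite dxy; apply: Hyw; lia.
Qed.

Lemma linked_eq H d H' d' N :
  (forall z, z <= N -> H z = H' z) -> (forall z, z < N -> d z = d' z) ->
  forall x y, x < N -> y < N -> linked H d x y = linked H' d' x y.
Proof.
move=> eH ed x y xN yN; rewrite /linked !ed //; congr (_ && _).
by apply: eq_in_all => z; rewrite mem_iota => zxy; rewrite eH //; lia.
Qed.

Section Profile.
Variables (N : nat) (H d : nat -> nat).
Hypothesis Hd : profile N H d.

(** A discrete intermediate value argument: going left from gap [x], the first point whose left gap
    has height at most [v] satisfies [d y <= v < (d y).+1]. *)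
Lemma profile_open x v : x <= N -> v < H x ->
  exists y, [/\ y < x, d y = v & forall z, y < z <= x -> v < H z].
Proof.
case: Hd => H0 _ Hs; elim: x => [|x IH] xN vx; first lia.
have [Hx1 Hx2] := Hs x xN.
have [vHx|Hxv] := ltnP v (H x).
  have [y [yx dy Hy]] := IH (ltnW xN) vHx.
  exists y; split=> //; first lia.
  by move=> z zy; have [->//|zx] := eqVneq z x.+1; apply: Hy; lia.
exists x; split=> //; first lia.
by move=> z zx; have -> : z = x.+1 by lia.
Qed.

(** Mirror image of [profile_open], by induction on the distance to [N], where the height is 0
    again. *)
Lemma profile_close x v : x <= N -> v < H x ->
  exists y, [/\ x <= y < N, d y = v & forall z, x <= z <= y -> v < H z].
Proof.
case: Hd => _ HN Hs; move: {2}(N - x) (erefl (N - x)) => k.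
elim: k x => [|k IH] x kx xN vx.
  by have xE : x = N by [lia]; rewrite xE HN in vx.
have xltN : x < N by lia.
have [Hx1 Hx2] := Hs x xltN.
have [vHx|Hxv] := ltnP v (H x.+1).
  have [||y [yx dy Hy]] := IH x.+1 _ _ vHx; try lia.
  exists y; split=> //; first lia.
  by move=> z zy; have [->//|zx] := eqVneq z x; apply: Hy; lia.
exists x; split; try lia.
by move=> z zx; have -> : z = x by lia.
Qed.

(** The inequality says that an arc arrives at [x]. This and [linked_after] identify the non-minimal
    and the non-maximal elements of the blocks. *)
Lemma linked_before x : x < N ->
  (d x < H x) <-> (exists2 y, y < x & linked H d y x).
Proof.
move=> xN; split=> [dH|[y yx /linkedP[dyx Hz]]]; last first.
  by rewrite -dyx; apply: Hz; lia.
have [||y [yx dy Hy]] := @profile_open x (d x); try lia.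
by exists y => //; apply/linkedP; split=> // z zyx; rewrite dy; apply: Hy; lia.
Qed.

Lemma linked_after x : x < N ->
  (d x < H x.+1) <-> (exists2 y, x < y < N & linked H d x y).
Proof.
move=> xN; split=> [dH|[y yx /linkedP[dyx Hz]]]; last by apply: Hz; lia.
have [||y [yx dy Hy]] := @profile_close x.+1 (d x); try lia.
by exists y => //; apply/linkedP; split=> // z zyx; apply: Hy; lia.
Qed.

(** The gap before [x] lies under the link from [w] to [y], so [d w <= d x]; the gap before [y] lies
    under the link from [x] to [z], so [d x <= d y]; and [d y = d w]. *)
Lemma linked_noncrossing w x y z : w < x -> x < y -> y < z -> z < N ->
  linked H d w y -> linked H d x z -> linked H d w x.
Proof.
move=> wx xy yz zN /linkedP[dwy Hwy] /linkedP[dxz Hxz].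
case: Hd => _ _ Hs; have [|Hx _] := Hs x; first lia.
have [|Hy _] := Hs y; first lia.
have := Hwy x; have := Hxz y => h1 h2.
apply/linkedP; split; first by lia.
by move=> t tx; apply: Hwy; lia.
Qed.

End Profile.

(** * The partition into classes of linked points *)

Section Partition.
Variable N : nat.

Definition link_partition (H d : nat -> nat) : {set {set 'I_N}} :=
  equivalence_partition (fun x y : 'I_N => linked H d x y) [set: 'I_N].

Lemma link_equivalence H d :
  {in [set: 'I_N] & &, equivalence_rel (fun x y : 'I_N => linked H d x y)}.
Proof.
move=> x y z _ _ _; split; first exact: linked_refl.
move=> xy; apply/idP/idP; last exact: linked_trans.
by apply: linked_trans; rewrite linked_sym.
Qed.

Lemma link_partitionP H d : partition (link_partition H d) [set: 'I_N].
Proof. exact: equivalence_partitionP (@link_equivalence H d). Qed.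

Lemma mem_pblock_link H d (x y : 'I_N) :
  (y \in pblock (link_partition H d) x) = linked H d x y.
Proof. by rewrite (pblock_equivalence_partition (@link_equivalence H d)) ?inE. Qed.

Lemma partition_eq (pi rho : {set {set 'I_N}}) :
  partition pi [set: 'I_N] -> partition rho [set: 'I_N] ->
  (forall x y, (y \in pblock pi x) = (y \in pblock rho x)) -> pi = rho.
Proof.
move=> Ppi Prho e.
suff sub (p q : {set {set 'I_N}}) : partition p [set: 'I_N] ->
    partition q [set: 'I_N] ->
    (forall x y, (y \in pblock p x) = (y \in pblock q x)) -> p \subset q.
  by apply/eqP; rewrite eqEsubset !sub // => x y; rewrite e.
move=> /and3P[/eqP cp tp np] /and3P[/eqP cq tq nq] epq.
apply/subsetP => X Xp.
have [x xX] : exists x, x \in X.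
  by apply/set0Pn; apply: contraNneq np => <-.
have -> : X = pblock q x.
  by rewrite -(def_pblock tp Xp xX); apply/setP => y; rewrite epq.
by apply: pblock_mem; rewrite cq inE.
Qed.

Lemma card_partition_minima (pi : {set {set 'I_N}}) :
  partition pi [set: 'I_N] ->
  #|pi| = #|[set x : 'I_N | [forall y in pblock pi x, x <= y]]|.
Proof.
move=> /and3P[/eqP cpi tpi npi].
have cov x : x \in cover pi by rewrite cpi inE.
set M := [set x | _].
have -> : pi = pblock pi @: M.
  apply/setP => X; apply/idP/imsetP => [Xpi|[x _ ->]]; last exact: pblock_mem.
  have [x0 x0X] : exists x, x \in X.
    by apply/set0Pn; apply: contraNneq npi => <-.
  case: (arg_minnP (fun x : 'I_N => val x) x0X) => x xX xmin.
  exists x; last by rewrite (def_pblock tpi Xpi xX).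
  by rewrite inE (def_pblock tpi Xpi xX); apply/forall_inP.
rewrite card_in_imset // => x y; rewrite !inE => /forall_inP xm /forall_inP ym e.
have xy : x <= y by apply: xm; rewrite e mem_pblock.
have yx : y <= x by apply: ym; rewrite -e mem_pblock.
by apply/val_inj/eqP; rewrite eqn_leq xy yx.
Qed.

Lemma link_partition_noncrossing H d : profile N H d ->
  noncrossing (link_partition H d).
Proof.
move=> Hd; have [_ tpi _] := and3P (link_partitionP H d).
apply/forall_inP => X Xpi; apply/forall_inP => Y Ypi; apply/implyP => XY.
apply/negP; case/existsP=> a /existsP[b] /existsP[c] /existsP[e].
case/and5P=> ab bc ce aX /and3P[cX bY eY]; case/eqP: XY.
have Xa := def_pblock tpi Xpi aX; have Yb := def_pblock tpi Ypi bY.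
rewrite -Yb; apply/esym/(def_pblock tpi Xpi); rewrite -Xa mem_pblock_link.
by apply: (linked_noncrossing Hd ab bc ce); rewrite ?ltn_ord // -mem_pblock_link ?Xa ?Yb.
Qed.

End Partition.

(** * Block count, rotation, and the arc counts of a noncrossing partition *)

Lemma card_steps N (f : nat -> nat) :
  (forall z, z < N -> f z <= f z.+1 <= (f z).+1) ->
  #|[set x : 'I_N | f x < f x.+1]| + f 0 = f N.
Proof.
move=> fs; rewrite -sum1dep_card big_mkcond /=.
have : forall K, K <= N ->
    \sum_(x < K) (if f x < f x.+1 then 1 else 0) + f 0 = f K.
  elim=> [|K IH] KN; first by rewrite big_ord0.
  by rewrite big_ord_recr /= addnAC (IH (ltnW KN)); have := fs K KN; case: ifP; lia.
exact.
Qed.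

(** Blocks are counted by their minima, which by [linked_before] are the points where no arc
    arrives. *)
Lemma card_link_partition N H d : profile N H d ->
  #|link_partition N H d| = #|[set x : 'I_N | d x == H x]|.
Proof.
move=> Hd; rewrite card_partition_minima; last exact: link_partitionP.
congr #|pred_of_set _|; apply/setP => x; rewrite !inE.
have [_ _ /(_ x (ltn_ord x)) [Hx _]] := Hd.
have B := linked_before Hd (ltn_ord x).
apply/forall_inP/eqP => [xmin|dx y].
  suff : ~ (d x < H x) by lia.
  case/B => y yx yxl; have yN : y < N by apply: ltn_trans yx _.
  have := xmin (Ordinal yN); rewrite mem_pblock_link linked_sym => /(_ yxl) /=.
  by rewrite leqNgt yx.
rewrite mem_pblock_link => xy; rewrite leqNgt; apply/negP => yx.
have : d x < H x by apply/B; exists (val y) => //; rewrite linked_sym.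
lia.
Qed.

Lemma rotate_link_partition N H d H' d' :
  (forall x y : 'I_N, linked H' d' (ordS x) (ordS y) = linked H d x y) ->
  rotate_partition (link_partition N H d) = link_partition N H' d'.
Proof.
move=> RS; rewrite /rotate_partition /link_partition /equivalence_partition.
have key (x : 'I_N) : @ordS N @: [set y in [set: 'I_N] | linked H d x y]
    = [set y in [set: 'I_N] | linked H' d' (ordS x) y].
  apply/setP => y; rewrite -(ord_predK y) (mem_imset _ _ (@ordS_inj N)) !inE.
  by rewrite RS.
apply/setP => X; apply/imsetP/imsetP => [[Y /imsetP[x _ ->] ->]|[x _ ->]].
  by exists (ordS x); rewrite ?inE.
exists [set y in [set: 'I_N] | linked H d (ord_pred x) y].
  by apply/imsetP; exists (ord_pred x); rewrite ?inE.
by rewrite key ord_predK.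
Qed.

(** The cyclic shift is the successor on pairs below [M], while [M] wraps around to 0; symmetry and
    reflexivity of [linked] cover the remaining pairs. *)
Lemma linked_rotation M H d H' d' :
  (forall x y, x < y < M -> linked H' d' x.+1 y.+1 = linked H d x y) ->
  (forall y, y < M -> linked H' d' 0 y.+1 = linked H d y M) ->
  forall x y, x <= M -> y <= M ->
    linked H' d' (x.+1 %% M.+1) (y.+1 %% M.+1) = linked H d x y.
Proof.
move=> inner outer x y xM yM.
wlog xy : x y xM yM / x <= y.
  move=> W; have [xy|yx] := leqP x y; first exact: W.
  by rewrite linked_sym (linked_sym H) W // ltnW.
have [->|nxy] := eqVneq x y; first by rewrite !linked_refl.
have [->|nyM] := eqVneq y M.
  by rewrite modnn modn_small; [rewrite linked_sym outer|]; lia.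
by rewrite !modn_small ?inner; lia.
Qed.

Lemma linked_succ H d H' d' x y : x < y ->
  (d' x.+1 == d' y.+1) = (d x == d y) ->
  (forall z, x < z <= y -> (d' x.+1 < H' z.+1) = (d x < H z)) ->
  linked H' d' x.+1 y.+1 = linked H d x y.
Proof.
move=> xy ed eH; apply/linkedP/linkedP => -[dxy Hz]; split.
- by apply/eqP; rewrite -ed dxy.
- by move=> z zxy; rewrite -eH; [apply: Hz|]; clear - xy zxy; lia.
- by apply/eqP; rewrite ed dxy.
- case=> [|z] zxy; first by clear - zxy; lia.
  by rewrite eH; [apply: Hz|]; clear - xy zxy; lia.
Qed.

Section Rotation.
Variables (M : nat) (H d H' d' : nat -> nat).
Hypotheses (Hd : profile M.+1 H d) (H'0 : H' 0 = 0) (d'0 : d' 0 = 0).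

(** With [H M = 0] no arc arrives at [M], which is then a singleton block; after the rotation 0 is
    one, because gap 1 is uncovered. *)
Lemma linked_rotation_singleton :
  (forall z, z <= M -> H' z.+1 = H z) -> (forall z, z < M -> d' z.+1 = d z) ->
  H M = 0 ->
  forall x y, x <= M -> y <= M ->
    linked H' d' (x.+1 %% M.+1) (y.+1 %% M.+1) = linked H d x y.
Proof.
move=> eH ed HM0; apply: linked_rotation => [x y xyM|y yM].
  apply/linkedP/linkedP => -[dxy Hz]; rewrite ?ed in dxy Hz *; try lia;
    split=> // z zxy.
    by rewrite -eH; [apply: Hz|]; lia.
  by case: z zxy => [|z] zxy; [lia|rewrite eH; [apply: Hz|]; lia].
apply/linkedP/linkedP => -[dxy Hz].
  by have := Hz 1; rewrite eH //; case: Hd; lia.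
by have := Hz M; lia.
Qed.

(* [p] is the first and [q] the last but one element of the block of [M]. *)
Variables p q : nat.
Hypotheses (pq : p <= q) (qM : q < M) (Hp : H p = 0) (dq : d q = 0)
  (Hpos : forall z, p < z <= M -> 0 < H z)
  (dpos : forall z, q < z < M -> 0 < d z)
  (eH : forall z, z <= M -> H' z.+1 + (q < z) + (p < z) = (H z).+1)
  (ed : forall z, z < M -> d' z.+1 + (q < z) + (p <= z) = (d z).+1).

(** The hypotheses [eH] and [ed] express the removal of the arc from [q] to [M] and the addition of
    an arc from 0 to [p.+1]. Heights rise by 1 up to [p], are kept up to [q] and drop by 1 beyond.
    Pairs below [M] in one zone keep their status; pairs from different zones are unlinked before
    and after. *)
Lemma linked_rotation_arc x y : x <= M -> y <= M ->
  linked H' d' (x.+1 %% M.+1) (y.+1 %% M.+1) = linked H d x y.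
Proof.
have [_ HM1 Hs] := Hd.
have dM : d M = 0 by have := Hs M (ltnSn M); lia.
have Hq1 : H q.+1 <= 1 by have := Hs q; lia.
have H'1 z : z <= p -> H' z.+1 = (H z).+1.
  by move=> zp; have := @eH z; clear - pq qM zp; lia.
have H'2 z : p < z <= q -> H' z.+1 = H z.
  by move=> zpq; have := @eH z; clear - pq qM zpq; lia.
have H'3 z : q < z <= M -> (H' z.+1).+1 = H z.
  by move=> zq; have := @eH z; clear - pq qM zq; lia.
have d'1 z : z < p -> d' z.+1 = (d z).+1.
  by move=> zp; have := @ed z; clear - pq qM zp; lia.
have d'2 z : p <= z <= q -> d' z.+1 = d z.
  by move=> zpq; have := @ed z; clear - pq qM zpq; lia.
have d'3 z : q < z < M -> (d' z.+1).+1 = d z.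
  by move=> zq; have := @ed z; clear - pq qM zq; lia.
(* Since [d q = 0], at most one arc covers the gap after [q]; it is the removed one. *)
have Hq2 : H' q.+2 = 0 by have := H'3 q.+1; clear - Hq1 qM; lia.
apply: linked_rotation => {x y} [x y /andP[xy yM]|y yM].
  have [yp|py] := ltnP y p.
    apply: linked_succ => // [|z zxy].
      by rewrite !d'1 ?eqSS //; clear - xy yp; lia.
    by rewrite d'1 ?H'1 //; clear - xy yp zxy; lia.
  have [xp|px] := ltnP x p.
    apply/linkedP/linkedP => -[_ Hz].
      by have := Hz p.+1; rewrite d'1 // H'1 // Hp; clear - xp py; lia.
    by have := Hz p; rewrite Hp; clear - xp py; lia.
  have [yq|qy] := leqP y q.
    apply: linked_succ => // [|z zxy].
      by rewrite !d'2 //; clear - xy yq px; lia.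
    by rewrite d'2 ?H'2 //; clear - xy yq px zxy; lia.
  have [xq|qx] := leqP x q.
    apply/linkedP/linkedP => -[dxy Hz].
      by have := Hz q.+2; rewrite Hq2; clear - xq qy; lia.
    by have := Hz q.+1; have := @dpos y; clear - dxy xq qy yM Hq1; lia.
  apply: linked_succ => // [|z zxy].
    by rewrite -(d'3 x) -1?(d'3 y) ?eqSS //; clear - xy yM qx qy; lia.
  by rewrite -(d'3 x) -1?(H'3 z) ?ltnS //; clear - xy yM qx zxy; lia.
(* Pairs with [M], which has depth 0: on both sides the link holds exactly when [p <= y <= q] and
   [d y = 0]. *)
have [yp|py] := ltnP y p.
  apply/linkedP/linkedP => -[dxy Hz].
    by move: dxy; rewrite d'0 d'1.
  by have := Hz p; rewrite Hp; clear - yp pq qM; lia.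
have [yq|qy] := leqP y q; last first.
  apply/linkedP/linkedP => -[dxy Hz].
    by have := Hz q.+2; rewrite Hq2; clear - qy; lia.
  by have := @dpos y; rewrite dxy dM; clear - qy yM; lia.
have dy : d' y.+1 = d y by rewrite d'2 ?py.
apply/linkedP/linkedP; rewrite d'0 dM dy => -[dxy Hz]; split=> // z zxy.
  by rewrite -dxy; apply: Hpos; clear - py yM zxy; lia.
case: z zxy => [|z] zxy; first by clear - zxy; lia.
have [zp|pz] := leqP z p; first by rewrite H'1.
rewrite H'2; last by clear - zxy yq pz; lia.
by apply: Hpos; clear - pz zxy yM; lia.
Qed.

End Rotation.

Section OpenBlocks.
Variables (N : nat) (pi : {set {set 'I_N}}).
Hypotheses (Ppi : partition pi [set: 'I_N]) (NCpi : noncrossing pi).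

(** A block with elements on both sides of a gap passes over it with exactly one arc, so arcs can be
    counted as blocks. The same holds for [covering_blocks], which are the blocks passing strictly
    over a point. *)
Definition open_blocks (z : nat) : {set {set 'I_N}} :=
  [set X in pi | [exists x : 'I_N in X, x < z] && [exists x : 'I_N in X, z <= x]].

Definition covering_blocks (z : nat) : {set {set 'I_N}} :=
  [set X in pi | [&& [exists x : 'I_N in X, x < z],
                     [exists x : 'I_N in X, z < x] &
                     [forall x : 'I_N in X, x != z :> nat]]].

Lemma block_pblock X x : X \in pi -> x \in X -> pblock pi x = X.
Proof. by move=> Xpi xX; apply: def_pblock Xpi xX; case/and3P: Ppi. Qed.

Lemma mem_own_block x : x \in pblock pi x.
Proof. by rewrite mem_pblock; case/and3P: Ppi => /eqP-> _ _; rewrite inE. Qed.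

Lemma own_block x : pblock pi x \in pi.
Proof. by apply: pblock_mem; case/and3P: Ppi => /eqP-> _ _; rewrite inE. Qed.

Lemma eq_own_block X x : X \in pi -> (X == pblock pi x) = (x \in X).
Proof.
move=> Xpi; apply/eqP/idP => [->|xX]; first exact: mem_own_block.
by rewrite (block_pblock Xpi).
Qed.

Lemma noncrossing_blocks X Y (a b c e : 'I_N) : X \in pi -> Y \in pi ->
  a \in X -> b \in Y -> c \in X -> e \in Y -> a < b -> b < c -> c < e -> X = Y.
Proof.
move=> Xpi Ypi aX bY cX eY ab bc ce; apply/eqP/negPn/negP => XY.
move/forall_inP: NCpi => /(_ X Xpi) /forall_inP /(_ Y Ypi).
rewrite XY /= => /negP[]; apply/existsP; exists a; apply/existsP; exists b.
apply/existsP; exists c; apply/existsP; exists e.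
by rewrite ab bc ce aX bY cX eY.
Qed.

Lemma covering_blocksP X (x : 'I_N) : X \in pi ->
  reflect [/\ exists2 y : 'I_N, y \in X & y < x,
              exists2 y : 'I_N, y \in X & x < y & x \notin X]
          (X \in covering_blocks x).
Proof.
move=> Xpi; rewrite inE Xpi /=; apply: (iffP and3P).
  case=> /exists_inP lt /exists_inP gt /forall_inP ne; split=> //.
  by apply/negP => /ne; rewrite eqxx.
case=> lt gt ne; split; [exact/exists_inP|exact/exists_inP|].
apply/forall_inP => y yX; apply: contraNneq ne => xy.
by have <- : y = x by apply: val_inj.
Qed.

Lemma covering_open (x : 'I_N) :
  covering_blocks x = open_blocks x :\ pblock pi x.
Proof.
apply/setP => X; have [Xpi|nXpi] := boolP (X \in pi); last first.
  by rewrite !inE (negPf nXpi) !andbF.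
rewrite [RHS]inE !in_set1 eq_own_block // [X in _ && X]inE Xpi /=.
apply/covering_blocksP/andP => //.
  case=> lt [y yX xy] nx; split=> //; apply/andP; split; first exact/exists_inP.
  by apply/exists_inP; exists y; last exact: ltnW.
case=> nx /andP[/exists_inP lt /exists_inP[y yX xy]]; split=> //.
exists y => //; rewrite ltn_neqAle xy andbT; apply: contraNneq nx => e.
by have -> : x = y by apply: val_inj.
Qed.

Lemma covering_openS (x : 'I_N) :
  covering_blocks x = open_blocks x.+1 :\ pblock pi x.
Proof.
apply/setP => X; have [Xpi|nXpi] := boolP (X \in pi); last first.
  by rewrite !inE (negPf nXpi) !andbF.
rewrite [RHS]inE !in_set1 eq_own_block // [X in _ && X]inE Xpi /=.
apply/covering_blocksP/andP => //.
  case=> [[y yX yx] gt nx]; split=> //; apply/andP; split; last exact/exists_inP.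
  by apply/exists_inP; exists y; last exact: ltnW.
case=> nx /andP[/exists_inP[y yX xy] /exists_inP gt]; split=> //.
exists y => //; rewrite ltn_neqAle -ltnS xy andbT; apply: contraNneq nx => e.
by have <- : y = x by apply: val_inj.
Qed.

Definition open_height (z : nat) : nat := #|open_blocks z|.
Definition covering_height (z : nat) : nat := #|covering_blocks z|.

Lemma open_profile : profile N open_height covering_height.
Proof.
split; rewrite /open_height /covering_height.
- apply: eq_card0 => X; rewrite inE; apply/negP => /and3P[_ /exists_inP[x _]].
  by rewrite ltn0.
- apply: eq_card0 => X; rewrite inE; apply/negP => /and3P[_ _ /exists_inP[x _]].
  by rewrite leqNgt ltn_ord.
- move=> z zN; rewrite -[z]/(nat_of_ord (Ordinal zN)); set x := Ordinal zN.
  split.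
  + rewrite covering_open (cardsD1 (pblock pi x) (open_blocks x)).
    by rewrite leq_addl -[X in _ <= X]add1n leq_add2r leq_b1.
  + rewrite covering_openS (cardsD1 (pblock pi x) (open_blocks x.+1)).
    by rewrite leq_addl -[X in _ <= X]add1n leq_add2r leq_b1.
Qed.

(** A block over only one of [x] and [y] would have elements both strictly between them and outside,
    and would cross their common block. *)
Lemma covering_same_block (x y : 'I_N) : x < y -> y \in pblock pi x ->
  covering_blocks x = covering_blocks y.
Proof.
move=> xy yx; have xx := mem_own_block x; have xpi := own_block x.
apply/setP => X; have [Xpi|nXpi] := boolP (X \in pi); last first.
  by rewrite !inE (negPf nXpi).
have xX : (x \in X) = (y \in X).
  apply/idP/idP => [xX|yX]; first by rewrite -(block_pblock Xpi xX).
  by rewrite -(block_pblock Xpi yX) (block_pblock xpi yx).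
apply/covering_blocksP/covering_blocksP => // -[[u uX ux] [v vX xv] nX].
  split; last by rewrite -xX.
    by exists u => //; apply: ltn_trans xy.
  exists v => //; have [//|vy|e] := ltngtP (val y) (val v).
    case/negP: nX; rewrite (_ : X = pblock pi x) //.
    exact: (@noncrossing_blocks _ _ u x v y).
  by case/negP: nX; rewrite xX (_ : y = v) //; apply: val_inj.
split; last by rewrite xX.
  exists u => //; have [//|xu|e] := ltngtP (val u) (val x).
    case/negP: nX; rewrite (_ : X = pblock pi x) //.
    by apply/esym; apply: (@noncrossing_blocks _ _ x u y v).
  by case/negP: nX; rewrite -xX (_ : x = u) //; apply: val_inj.
by exists v => //; apply: ltn_trans xv.
Qed.

(** The blocks covering [x] also cover [y], hence are open at every gap between; the common block of
    [x] and [y] is open there in addition. *)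
Lemma linked_pblock_lt (x y : 'I_N) : x < y -> y \in pblock pi x ->
  linked open_height covering_height x y.
Proof.
move=> xy yx; have cxy := covering_same_block xy yx.
apply/linkedP; split; first by rewrite /covering_height cxy.
move=> z zxy; apply: proper_card; apply/properP; split.
  apply/subsetP => X Xx.
  have Xpi : X \in pi by move: Xx; rewrite inE => /andP[].
  have Xy : X \in covering_blocks y by rewrite -cxy.
  case/(covering_blocksP _ Xpi): Xx => -[u uX ux] _ _.
  case/(covering_blocksP _ Xpi): Xy => _ [v vX yv] _.
  rewrite inE Xpi /=; apply/andP; split; apply/exists_inP; first by exists u; lia.
  by exists v; lia.
exists (pblock pi x); last first.
  by apply/negP => /(covering_blocksP _ (own_block x)) [_ _]; rewrite mem_own_block.
rewrite inE own_block /=; apply/andP; split; apply/exists_inP.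
  by exists x; [exact: mem_own_block|lia].
by exists y; [|lia].
Qed.

(** Induction on the distance: an element of either block strictly between [x] and [y] yields a
    closer linked pair. *)
Lemma pblock_linked_lt (x y : 'I_N) : x < y ->
  linked open_height covering_height x y -> y \in pblock pi x.
Proof.
move: {2}(y - x).+1 (ltnSn (y - x)) => k; elim: k x y => [//|k IH] x y kxy xy xly.
have sameE (u v : 'I_N) : v \in pblock pi u -> pblock pi v = pblock pi u.
  by move=> vu; apply: block_pblock vu; apply: own_block.
have [/exists_inP[w wx /andP[xw wy]]|/exists_inPn nx] :=
    boolP [exists w in pblock pi x, x < w < y].
  rewrite -(sameE _ _ wx); apply: IH => //; first lia.
  by apply: linked_trans xly; rewrite linked_sym; apply: linked_pblock_lt.
have [/exists_inP[w wy /andP[xw wlty]]|/exists_inPn ny] :=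
    boolP [exists w in pblock pi y, x < w < y].
  suff wx : w \in pblock pi x.
    by rewrite -(sameE _ _ wx) (sameE _ _ wy) mem_own_block.
  apply: IH => //; first lia.
  apply: linked_trans xly _; rewrite linked_sym; apply: linked_pblock_lt => //.
  by rewrite (sameE _ _ wy) mem_own_block.
have [->|] := eqVneq y x; first exact: mem_own_block.
(* Neither block now has an element strictly between [x] and [y]. The link makes the block of [x]
   open after [x] and that of [y] open before [y]. If they differ, they contain some [u > y] and
   [v < x] respectively, and [v < x < y < u] is a crossing. *)
move=> yx; case: (boolP (y \in pblock pi x)) => // nyx.
have /linkedP[dxy Hz] := xly.
have pbx : pblock pi x \in open_blocks x.+1.
  have xz : minn x y < x.+1 <= maxn x y by lia.
  have := Hz _ xz; rewrite /open_height /covering_height covering_openS.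
  by rewrite (cardsD1 (pblock pi x) (open_blocks x.+1)); case: (_ \in _);
    rewrite ?add0n ?ltnn.
have pby : pblock pi y \in open_blocks y.
  have yz : minn x y < y <= maxn x y by lia.
  have := Hz _ yz; rewrite dxy /open_height /covering_height covering_open.
  by rewrite (cardsD1 (pblock pi y) (open_blocks y)); case: (_ \in _);
    rewrite ?add0n ?ltnn.
move: pbx; rewrite inE => /and3P[_ _ /exists_inP[u ux xu]].
move: pby; rewrite inE => /and3P[_ /exists_inP[v vy vlty] _].
have nuy : u != y by apply: contraNneq nyx => <-.
have nvx : v != x.
  by apply: contraNneq nyx => e; rewrite -e (sameE _ _ vy) mem_own_block.
have yu : y < u.
  have := nx u ux; move: nuy; rewrite -val_eqE /=; lia.
have vx : v < x.
  have := ny v vy; move: nvx; rewrite -val_eqE /=; lia.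
case/negP: nyx; rewrite -(@noncrossing_blocks (pblock pi y) (pblock pi x) v x y u) //;
  by rewrite ?own_block ?mem_own_block.
Qed.

Lemma link_partition_open : link_partition N open_height covering_height = pi.
Proof.
apply: partition_eq => //; first exact: link_partitionP.
move=> x y; rewrite mem_pblock_link; have [xy|yx|e] := ltngtP x y.
- by apply/idP/idP; [exact: pblock_linked_lt|exact: linked_pblock_lt].
- have sym : (y \in pblock pi x) = (x \in pblock pi y).
    by apply/idP/idP => /(block_pblock (own_block _)) ->; rewrite mem_own_block.
  rewrite linked_sym sym.
  by apply/idP/idP; [exact: pblock_linked_lt|exact: linked_pblock_lt].
- have -> : x = y by apply: val_inj.
  by rewrite linked_refl mem_own_block.
Qed.

End OpenBlocks.

(** * Rowmotion and promotion slices *)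

Section Rowmotion.
Variables (disp : Order.disp_t) (P : finPOrderType disp).
Implicit Types (I : {set P}) (p q : P).

Lemma order_idealP I :
  reflect (forall p q, p \in I -> (q <= p)%O -> q \in I) (order_ideal I).
Proof.
apply: (iffP forall_inP) => [Id p q pI qp|Id p pI].
  by have /forallP/(_ q)/implyP := Id p pI; apply.
by apply/forallP => q; apply/implyP; apply: Id.
Qed.

Lemma rowmotion_ideal I : order_ideal (rowmotion I).
Proof.
apply/order_idealP => p q; rewrite !inE => /exists_inP[r rm pr] qp.
by apply/exists_inP; exists r => //; apply: Order.POrderTheory.le_trans pr.
Qed.

Lemma rowmotionP I p :
  reflect (exists r, [/\ r \notin I, forall q, (q < r)%O -> q \in I & (p <= r)%O])
          (p \in rowmotion I).
Proof.
rewrite inE; apply: (iffP exists_inP) => [[r]|[r [rI rmin pr]]].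
  rewrite !inE => /andP[rI /forall_inP rmin] pr; exists r; split=> // q qr.
  by apply/negPn/negP => nq; have := rmin q; rewrite inE qr => /(_ nq).
exists r => //; rewrite !inE rI; apply/forall_inP => q; rewrite inE.
by apply: contraNN; apply: rmin.
Qed.

Lemma rowmotion_lt I p q : p \in rowmotion I -> (q < p)%O -> q \in I.
Proof.
case/rowmotionP=> r [_ rmin pr] qp; apply: rmin.
exact: Order.POrderTheory.lt_le_trans pr.
Qed.

Lemma rowmotion_notin I p : p \notin I ->
  (forall q, (q < p)%O -> q \in I) -> p \in rowmotion I.
Proof. by move=> pI pmin; apply/rowmotionP; exists p; split. Qed.

Lemma rowmotion_in I p : p \in I -> p \in rowmotion I ->
  exists2 q, (p < q)%O & q \in rowmotion I.
Proof.
move=> pI /rowmotionP[r [rI rmin pr]]; exists r.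
  rewrite Order.POrderTheory.lt_neqAle pr andbT.
  by apply: contraNneq rI => <-.
by apply/rowmotionP; exists r; split.
Qed.

End Rowmotion.

Section Cells.
Variables m n : nat.
Notation P := (chain_product3 2 m n).
Implicit Types I : {set P}.

(* Coordinates range over [nat], with value [false] outside the box. *)
Definition cell I (h j k : nat) : bool :=
  [exists p : P, [&& p \in I, p.1.1 == h :> nat, p.1.2 == j :> nat
                            & p.2 == k :> nat]].

Lemma cellE I (p : P) : cell I p.1.1 p.1.2 p.2 = (p \in I).
Proof.
apply/existsP/idP => [[q]|pI]; last by exists p; rewrite pI !eqxx.
case/and4P=> qI /eqP e1 /eqP e2 /eqP e3.
by have <- : q = p by case: q p e1 e2 e3 {qI} => [[? ?] ?] [[? ?] ?] /=
  /val_inj-> /val_inj-> /val_inj->.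
Qed.

Lemma cell_bound I h j k : cell I h j k -> [/\ h < 2, j < m & k < n].
Proof. by case/existsP=> p /and4P[_ /eqP<- /eqP<- /eqP<-]; split. Qed.

Definition pt h j k (hh : h < 2) (jm : j < m) (kn : k < n) : P :=
  ((Ordinal hh, Ordinal jm), Ordinal kn).

Lemma cell_pt I h j k (hh : h < 2) (jm : j < m) (kn : k < n) :
  cell I h j k = (pt hh jm kn \in I).
Proof. by rewrite -cellE. Qed.

Lemma cell_inj I I' : (forall h j k, h < 2 -> j < m -> k < n ->
  cell I h j k = cell I' h j k) -> I = I'.
Proof. by move=> e; apply/setP => p; rewrite -!cellE e. Qed.

Lemma pt_lt (p q : P) :
  (p < q)%O = [&& p.1.1 <= q.1.1, p.1.2 <= q.1.2, p.2 <= q.2 &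
                  [|| p.1.1 < q.1.1, p.1.2 < q.1.2 | p.2 < q.2]]%N.
Proof.
rewrite Order.POrderTheory.lt_leAnge !chain_product3_leE; lia.
Qed.

Lemma cell_down I h j k h' j' k' : order_ideal I -> cell I h j k ->
  h' <= h -> j' <= j -> k' <= k -> cell I h' j' k'.
Proof.
move=> /order_idealP Id hjk hh jj kk; have [h2 jm kn] := cell_bound hjk.
move: hjk; rewrite (cell_pt I h2 jm kn) => pI.
rewrite (cell_pt I (leq_ltn_trans hh h2) (leq_ltn_trans jj jm) (leq_ltn_trans kk kn)).
by apply: Id pI _; rewrite chain_product3_leE /= hh jj kk.
Qed.

Definition cells (Q : nat -> nat -> nat -> bool) : {set P} :=
  [set p : P | Q p.1.1 p.1.2 p.2].

Lemma cell_cells Q h j k :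
  cell (cells Q) h j k = [&& h < 2, j < m, k < n & Q h j k].
Proof.
apply/idP/and4P => [c|[h2 jm kn]]; last by rewrite (cell_pt _ h2 jm kn) inE.
have [h2 jm kn] := cell_bound c; split=> //.
by move: c; rewrite (cell_pt _ h2 jm kn) inE.
Qed.

Lemma cells_ideal (Q : nat -> nat -> nat -> bool) :
  (forall h j k h' j' k', h < 2 -> j < m -> k < n ->
    h' <= h -> j' <= j -> k' <= k -> Q h j k -> Q h' j' k') ->
  order_ideal (cells Q).
Proof.
move=> Qd; apply/order_idealP => p q; rewrite !inE chain_product3_leE.
by move=> Qp /and3P[h j k]; apply: Qd Qp.
Qed.

Lemma cell_rowmotion_notin I h j k : order_ideal I ->
  h < 2 -> j < m -> k < n -> ~~ cell I h j k ->
  cell (rowmotion I) h j k =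
  [&& (0 < h) ==> cell I h.-1 j k, (0 < j) ==> cell I h j.-1 k
    & (0 < k) ==> cell I h j k.-1].
Proof.
move=> Id h2 jm kn nc; apply/idP/and3P => [c|[ch cj ck]].
  have low h' j' k' : h' <= h -> j' <= j -> k' <= k -> h' + j' + k' < h + j + k ->
      cell I h' j' k'.
    move=> hh jj kk lt; move: c; rewrite (cell_pt _ h2 jm kn) => c.
    rewrite (cell_pt I (leq_ltn_trans hh h2) (leq_ltn_trans jj jm)
      (leq_ltn_trans kk kn)).
    by apply: rowmotion_lt c _; rewrite pt_lt /=; lia.
  by split; apply/implyP => ?; apply: low; lia.
rewrite (cell_pt _ h2 jm kn); apply: rowmotion_notin.
  by rewrite -(cell_pt I h2 jm kn).
move=> q; rewrite pt_lt /= -cellE.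
move: (nat_of_ord q.1.1) (nat_of_ord q.1.2) (nat_of_ord q.2) => a b c.
case/and4P=> ah bj ck' /or3P[lt|lt|lt].
- by have /(cell_down Id) := implyP ch (leq_ltn_trans (leq0n _) lt); apply; lia.
- by have /(cell_down Id) := implyP cj (leq_ltn_trans (leq0n _) lt); apply; lia.
- by have /(cell_down Id) := implyP ck (leq_ltn_trans (leq0n _) lt); apply; lia.
Qed.

Lemma cell_rowmotion_in I h j k : cell I h j k ->
  cell (rowmotion I) h j k =
  [|| cell (rowmotion I) h.+1 j k, cell (rowmotion I) h j.+1 k
    | cell (rowmotion I) h j k.+1].
Proof.
move=> c; have Rd := @cell_down _ _ _ _ _ _ _ (rowmotion_ideal I).
apply/idP/or3P; last by case=> /Rd; apply; lia.
have [h2 jm kn] := cell_bound c.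
rewrite (cell_pt I h2 jm kn) in c; rewrite (cell_pt _ h2 jm kn) => r.
have [q] := rowmotion_in c r; rewrite pt_lt /= -cellE.
case/and4P=> qh qj qk /or3P[lt|lt|lt] cq.
- by apply: Or31; apply: Rd cq _ _ _.
- by apply: Or32; apply: Rd cq _ _ _.
- by apply: Or33; apply: Rd cq _ _ _.
Qed.

(** A cell outside [I] has nothing of the image strictly above it, which settles the first branch;
    the second is [cell_rowmotion_notin]. On the right [I] occurs only at lower neighbours, so this
    serves as a recursion for [I]. *)
Lemma cell_rowmotion_inv I h j k : order_ideal I -> h < 2 -> j < m -> k < n ->
  cell I h j k =
  if cell (rowmotion I) h j k
  then [|| cell (rowmotion I) h.+1 j k, cell (rowmotion I) h j.+1 k
         | cell (rowmotion I) h j k.+1]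
  else [&& (0 < h) ==> cell I h.-1 j k, (0 < j) ==> cell I h j.-1 k
         & (0 < k) ==> cell I h j k.-1].
Proof.
move=> Id h2 jm kn; have [c|nc] := boolP (cell I h j k).
  rewrite -cell_rowmotion_in //; case: ifP => // _; apply/esym.
  by apply/and3P; split; apply/implyP => ?; apply: cell_down c _ _ _; lia.
rewrite -cell_rowmotion_notin //; case: ifP => // _; apply/esym/negbTE.
have up h' j' k' : h <= h' -> j <= j' -> k <= k' -> h + j + k < h' + j' + k' ->
    ~~ cell (rowmotion I) h' j' k'.
  move=> hh jj kk lt; apply: contraNN nc => c; have [h2' jm' kn'] := cell_bound c.
  move: c; rewrite (cell_pt _ h2' jm' kn') (cell_pt _ h2 jm kn) => c.
  by apply: rowmotion_lt c _; rewrite pt_lt /=; lia.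
by rewrite !negb_or !up //; lia.
Qed.

Lemma iter_rowmotion_ideal t I : order_ideal I ->
  order_ideal (iter t (@rowmotion _ P) I).
Proof. by case: t => [//|t] _; apply: rowmotion_ideal. Qed.

Definition slice I h j k : bool := cell (iter j (@rowmotion _ P) I) h j k.

(** In the directions [h] and [k] one iterate is an ideal. A step down in [j] also goes back one
    iterate, and whatever lies strictly below a cell of the image of rowmotion belongs to the
    previous ideal. *)
Lemma slice_down I h j k h' j' k' : order_ideal I -> slice I h j k ->
  h' <= h -> j' <= j -> k' <= k -> slice I h' j' k'.
Proof.
move=> Id s hh jj kk.
have {s}: slice I h' j k' :=
  cell_down (iter_rowmotion_ideal j Id) s hh (leqnn j) kk.
elim: j jj => [|j IH] jj; first by have -> : j' = 0 by lia.
have [->//|ne] := eqVneq j' j.+1.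
move=> s; apply: IH; first lia.
have [h2 jm kn] := cell_bound s.
move: s; rewrite /slice (cell_pt _ h2 jm kn) (cell_pt _ h2 (ltnW jm) kn) iterS => s.
by apply: rowmotion_lt s _; rewrite pt_lt /=; lia.
Qed.

Lemma slice_bound I h j k : slice I h j k -> [/\ h < 2, j < m & k < n].
Proof. exact: cell_bound. Qed.

Lemma slice_rowmotion I h j k :
  slice (rowmotion I) h j k = cell (rowmotion (iter j (@rowmotion _ P) I)) h j k.
Proof. by rewrite /slice -iterSr. Qed.

(** The cell at [j.-1] of the [j]-th iterate belongs to the slice of [rowmotion I], whence the mixed
    second condition. Dually, in [slice_rowmotion_in] the cell at [j.+1] of the next iterate belongs
    to the slice of [I]. *)
Lemma slice_rowmotion_notin I h j k : order_ideal I ->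
  h < 2 -> j < m -> k < n -> ~~ slice I h j k ->
  slice (rowmotion I) h j k =
  [&& (0 < h) ==> slice I h.-1 j k, (0 < j) ==> slice (rowmotion I) h j.-1 k
    & (0 < k) ==> slice I h j k.-1].
Proof.
move=> Id h2 jm kn ns.
rewrite slice_rowmotion (cell_rowmotion_notin (iter_rowmotion_ideal j Id)) //.
by case: j jm ns => [//|j] jm ns; rewrite (slice_rowmotion I h j k).
Qed.

Lemma slice_rowmotion_in I h j k : slice I h j k ->
  slice (rowmotion I) h j k =
  [|| slice (rowmotion I) h.+1 j k, slice I h j.+1 k
    | slice (rowmotion I) h j k.+1].
Proof. 
move=> s; rewrite !slice_rowmotion; exact: (cell_rowmotion_in s).
 Qed.

Lemma slice_inj I I' : order_ideal I -> order_ideal I' ->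
  (forall h j k, h < 2 -> j < m -> k < n -> slice I h j k = slice I' h j k) ->
  I = I'.
Proof.
move=> Id Id' e.
pose F t := cell (iter t (@rowmotion _ P) I).
pose F' t := cell (iter t (@rowmotion _ P) I').
(* The value at time [t] of a cell is determined by values with a smaller
   rank - 2t, down to the plane t = j where the slices agree. *)
suff FF w t h j k : t <= j -> h + j + k + m < w + 2 * t -> F t h j k = F' t h j k.
  by apply: cell_inj => h j k _ _ _; apply: (FF (h + j + k + m).+1 0); lia.
elim: w t h j k => [|w IH] t h j k tj.
  (* Together with [t <= j] the bound puts the cell outside the box. *)
  move=> lt; have mj : m <= j by lia.
  by apply/idP/idP => /cell_bound[]; lia.
move=> lt; have [/and3P[h2 jm kn]|nb] := boolP [&& h < 2, j < m & k < n]; last first.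
  by apply/idP/idP => /cell_bound[h2 jm kn]; rewrite h2 jm kn in nb.
have [->|ntj] := eqVneq t j; first exact: e.
have up : F t.+1 h j k = F' t.+1 h j k by apply: IH; lia.
have low : [&& (0 < h) ==> F t h.-1 j k, (0 < j) ==> F t h j.-1 k
    & (0 < k) ==> F t h j k.-1]
  = [&& (0 < h) ==> F' t h.-1 j k, (0 < j) ==> F' t h j.-1 k
    & (0 < k) ==> F' t h j k.-1].
  congr [&& _, _ & _].
  - by case: h lt {up h2} => //= h lt; rewrite IH; lia.
  - by case: j tj lt jm ntj {up} => //= j tj lt jm ntj; rewrite IH; lia.
  - by case: k lt {up kn} => //= k lt; rewrite IH; lia.
have high : [|| F t.+1 h.+1 j k, F t.+1 h j.+1 k | F t.+1 h j k.+1]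
  = [|| F' t.+1 h.+1 j k, F' t.+1 h j.+1 k | F' t.+1 h j k.+1].
  by congr [|| _, _ | _]; apply: IH; clear - tj ntj lt; lia.
have Fd := iter_rowmotion_ideal t Id; have Fd' := iter_rowmotion_ideal t Id'.
rewrite /F /F' (cell_rowmotion_inv Fd) // (cell_rowmotion_inv Fd') //.
by move: up low high; rewrite /F /F' /= => -> -> ->.
Qed.

End Cells.

(** * Two-row increasing tableaux *)

Lemma downward_ind n (Q : nat -> Prop) :
  (forall k, k < n -> (k.+1 < n -> Q k.+1) -> Q k) -> forall k, k < n -> Q k.
Proof.
move=> step k kn; move: {2}(n - k) (erefl (n - k)) => i.
by elim: i k kn => [|i IH] k kn ik; [lia|apply: step => // ?; apply: IH; lia].
Qed.

Lemma last_index n (Q : pred nat) : 0 < n -> Q 0 ->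
  exists k, [/\ k < n, Q k & forall i, k < i < n -> ~~ Q i].
Proof.
move=> + Q0; elim: n => [//|[|n] IH] _; first by exists 0; split=> // i; lia.
have [//|k [kn Qk kmax]] := IH.
case Qn: (Q n.+1); first by exists n.+1; split=> // i; lia.
exists k; split=> // [|i ik]; first lia.
by have [->|ni] := eqVneq i n.+1; [rewrite Qn|apply: kmax; lia].
Qed.

Section Tableau.
Variable n : nat.

Definition increasing (f : nat -> nat) : Prop :=
  forall i j, i < j -> j < n -> f i < f j.

Definition below (f : nat -> nat) (z : nat) : nat :=
  threshold (fun k => f k < z) n.

Lemma belowP f z k : increasing f -> k < n -> (f k < z) = (k < below f z).
Proof.
move=> fi kn; apply: (thresholdP (Q := fun k => f k < z)) kn => i j ij jn.
have [->//|nij] := eqVneq i j.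
by have := fi i j; lia.
Qed.

Lemma below_le f z : below f z <= n.
Proof. exact: threshold_le. Qed.

Lemma below_step f z : increasing f -> below f z <= below f z.+1 <= (below f z).+1.
Proof.
move=> fi; have B := belowP; have c := below_le f z; have c' := below_le f z.+1.
apply/andP; split; rewrite leqNgt; apply/negP => lt.
  have k : below f z.+1 < n by lia.
  by have := B f z _ fi k; have := B f z.+1 _ fi k; lia.
have k : below f z < n by lia.
have k' : (below f z).+1 < n by lia.
have := fi _ _ (ltnSn _) k'; have := B f z _ fi k; have := B f z.+1 _ fi k'; lia.
Qed.

Lemma below0 f : below f 0 = 0.
Proof. by apply: threshold_unique. Qed.

Lemma below_all f z : (forall k, k < n -> f k < z) -> below f z = n.
Proof. by move=> fz; apply: threshold_unique => // k kn; rewrite fz. Qed.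

(** Arcs opened before [z] minus arcs closed before [z]; [point_depth] also discounts an arc closed
    at [z]. By [below_rows] the truncated subtractions are exact. *)
Definition gap_height (a b : nat -> nat) (z : nat) : nat := below a z - below b z.
Definition point_depth (a b : nat -> nat) (z : nat) : nat := below a z - below b z.+1.

Section Rows.
Variables (N : nat) (a b : nat -> nat).
Hypotheses (ai : increasing a) (bi : increasing b)
  (ab : forall k, k < n -> a k < b k) (bN : forall k, k < n -> b k < N).

Lemma below_rows z : below b z.+1 <= below a z.
Proof.
rewrite leqNgt; apply/negP => lt; have cb := below_le b z.+1.
have k : below a z < n by lia.
by have := belowP z ai k; have := belowP z.+1 bi k; have := ab k; lia.
Qed.

Lemma tableau_profile : profile N (gap_height a b) (point_depth a b).
Proof.
split; rewrite /gap_height /point_depth.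
- by rewrite !below0.
- by rewrite !below_all ?subnn // => k kn; have := ab kn; have := bN kn; lia.
- move=> z zN; have := below_rows z.
  by have := below_step z ai; have := below_step z bi; lia.
Qed.

End Rows.

Section Promotion.
Variables (M : nat) (a b a' b' : nat -> nat).
Hypotheses (n0 : 0 < n) (ai : increasing a) (bi : increasing b)
  (ab : forall k, k < n -> a k < b k) (bM : forall k, k < n -> b k < M.+1).

Lemma linked_promotion_singleton :
  b n.-1 < M ->
  (forall k, k < n -> a' k = (a k).+1) -> (forall k, k < n -> b' k = (b k).+1) ->
  forall x y, x <= M -> y <= M ->
    linked (gap_height a' b') (point_depth a' b') (x.+1 %% M.+1) (y.+1 %% M.+1)
    = linked (gap_height a b) (point_depth a b) x y.
Proof.
move=> bn ea eb.
have sh f f' z : increasing f -> (forall k, k < n -> f' k = (f k).+1) ->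
    below f' z.+1 = below f z.
  move=> fi ef; apply: threshold_unique; first exact: below_le.
  by move=> k kn; rewrite ef // ltnS -belowP.
apply: (linked_rotation_singleton (tableau_profile ai bi ab bM)).
- by rewrite /gap_height !below0.
- by rewrite /point_depth !below0.
- by move=> z _; rewrite /gap_height !(sh _ _ _ _ ea) ?(sh _ _ _ _ eb).
- by move=> z _; rewrite /point_depth (sh _ _ _ _ ea) ?(sh _ _ _ _ eb).
- have ball k : k < n -> b k < M.
    by move=> kn; have [->//|nk] := eqVneq k n.-1; have := bi (i := k) (j := n.-1); lia.
  by rewrite /gap_height !below_all ?subnn // => k kn; have := ball k kn; have := ab kn; lia.
Qed.

(* [k1] is the index of the predecessor of [M] in its block, and [k0] that of
   the minimum of the block. *)
Lemma linked_promotion_arc k0 k1 :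
  b n.-1 = M -> k0 <= k1 -> k1 < n ->
  (k0 == 0) || (b k0.-1 < a k0) -> (forall k, k0 < k < n -> a k <= b k.-1) ->
  (k1 == 0) || (b k1.-1 <= a k1) -> (forall k, k1 < k < n -> a k < b k.-1) ->
  (forall k, k < n ->
     a' k = if k <= k1 then (if k is i.+1 then (a i).+1 else 0) else (a k).+1) ->
  (forall k, k < n -> b' k = if k < k0 then (b k).+1
     else if k == k0 then (a k0).+1 else (b k.-1).+1) ->
  forall x y, x <= M -> y <= M ->
    linked (gap_height a' b') (point_depth a' b') (x.+1 %% M.+1) (y.+1 %% M.+1)
    = linked (gap_height a b) (point_depth a b) x y.
Proof.
move=> bn k01 k1n Q0 Q0max Q1 Q1max ea eb.
have k0n : k0 < n by lia.
have A z k : k < n -> (a k < z) = (k < below a z) by apply: belowP.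
have B z k : k < n -> (b k < z) = (k < below b z) by apply: belowP.
(* Up to the shift by 1, the first row loses [a k1] and gains the entry 0. *)
have ea' z : below a' z.+1 + (a k1 < z) = (below a z).+1.
  have Ak1 := A z k1 k1n; have An := below_le a z.
  suff -> : below a' z.+1 = (below a z).+1 - (a k1 < z) by lia.
  apply: threshold_unique; first lia.
  move=> k kn; rewrite ea //; have Ak := A z k kn.
  case: k kn Ak => [|k] kn Ak; first by rewrite leq0n; lia.
  by have := A z k; case: ifP; lia.
(* The second row loses [M], which no [z <= M] sees, and gains [(a k0).+1]. *)
have eb' z : z <= M -> below b' z.+1 = below b z + (a k0 < z).
  move=> zM; have Bn1 := B z n.-1; have Bk0 := B z k0; have Bk0' := B z k0.-1.
  have abk0 := ab k0n; have Bn := below_le b z.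
  apply: threshold_unique; first lia.
  move=> k kn; rewrite eb //; have Bk := B z k kn.
  case: (ltngtP k k0) => kk.
  - by have := Bk0' (leq_ltn_trans (leq_pred k0) k0n); clear - Bk Q0 kk; lia.
  - have := Bk0 k0n; have := B z k.-1 (leq_ltn_trans (leq_pred k) kn).
    by clear - abk0 kk; lia.
  - have := Bk0 k0n; have := Bk0' (leq_ltn_trans (leq_pred k0) k0n).
    by clear - abk0 Q0 kk; lia.
have abk1 := ab k1n; have bMk1 := bM k1n.
have Hr z := below_rows ai bi ab z.
have bst z := below_step z bi.
have below_n z : z <= M -> below b z < n.
  by have := B z n.-1; have := below_le b z; lia.
have a_at k : k < n -> below a (a k) = k.
  move=> kn; apply: threshold_unique; first exact: ltnW.
  move=> i ilt; have [lt|gt|->] := ltngtP i k; last by rewrite ltnn.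
    by rewrite ai.
  by have := ai gt ilt; lia.
have b_at k z : k < n -> (k == 0) || (b k.-1 < z) -> z <= b k -> below b z = k.
  move=> kn bk zk; apply: threshold_unique; first exact: ltnW.
  move=> i ilt; have [lt|gt|->] := ltngtP i k; last by lia.
    have [->|ne] := eqVneq i k.-1; first lia.
    by have := bi (i := i) (j := k.-1); lia.
  by have := bi gt ilt; lia.
have k01a : a k0 <= a k1.
  by have [->//|ne] := eqVneq k0 k1; apply/ltnW/ai; lia.
(* If gap [z] were uncovered, the index [j = below b z] would exceed [k0], and maximality of [k0]
   would give [a j <= b j.-1 < z], hence [below a z > j]. The proof of [dpos] is the same with
   [k1]. *)
have Hpos z : a k0 < z <= M -> 0 < gap_height a b z.
  move=> /andP[pz zM]; rewrite /gap_height subn_gt0 ltnNge; apply/negP => le.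
  have bz := below_n z zM; have := Q0max (below b z).
  have := A z (below b z) bz; have := A z k0 k0n.
  by have := B z (below b z).-1; lia.
have dpos z : a k1 < z < M -> 0 < point_depth a b z.
  move=> /andP[pz zM]; rewrite /point_depth subn_gt0 ltnNge; apply/negP => le.
  have bz := below_n z.+1 zM; have := Q1max (below b z.+1).
  have := A z (below b z.+1) bz; have := A z k1 k1n.
  by have := B z.+1 (below b z.+1).-1; lia.
apply: (@linked_rotation_arc M _ _ _ _ (tableau_profile ai bi ab bM) _ _
  (a k0) (a k1)) => //.
- by rewrite /gap_height !below0.
- by rewrite /point_depth below0 sub0n.
- lia.
- by rewrite /gap_height a_at // (b_at k0) ?subnn //; have := ab k0n; lia.
- by rewrite /point_depth a_at // (b_at k1) ?subnn //; lia.
- move=> z zM; rewrite /gap_height eb' //; have := ea' z; have := Hpos z.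
  have := Hr z; have := bst z; rewrite /gap_height; lia.
- move=> z zM; rewrite /point_depth eb' //; have := ea' z; have := dpos z.
  have := Hr z; rewrite /point_depth; lia.
Qed.

End Promotion.
End Tableau.

(** * Tableaux and noncrossing partitions determine each other *)

Lemma eq_below n f g z : (forall k, k < n -> f k = g k) -> below n f z = below n g z.
Proof.
by move=> fg; apply: eq_in_count => k; rewrite mem_iota => /andP[_ kn]; rewrite fg.
Qed.

Lemma increasing_bounds n f k : increasing n f -> k < n ->
  f 0 + k <= f k /\ f k + (n.-1 - k) <= f n.-1.
Proof.
move=> fi kn; have step i : i.+1 < n -> f i < f i.+1 by apply: fi.
split.
  elim: k kn => [|k IH] kn; first by rewrite addn0.
  by have := IH (ltnW kn); have := step k; lia.
move: k kn; apply: downward_ind => k kn IH.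
have [->|nk] := eqVneq k n.-1; first by rewrite subnn addn0.
by have := IH; have := step k; lia.
Qed.

Lemma eq_link_partition N H d H' d' :
  (forall z, z <= N -> H z = H' z) -> (forall z, z < N -> d z = d' z) ->
  link_partition N H d = link_partition N H' d'.
Proof.
move=> eH ed; apply: partition_eq; try exact: link_partitionP.
by move=> x y; rewrite !mem_pblock_link; apply: (linked_eq (N := N)).
Qed.

Section StepInverse.
Variables (N n : nat) (f : nat -> nat).
Hypotheses (f0 : f 0 = 0) (fN : f N = n)
  (fstep : forall z, f z <= f z.+1 <= (f z).+1).

(** For [k < n], the place of step number [k]: the [z] with [f z = k] and [f z.+1 = k.+1]. *)
Definition step_inverse (k : nat) : nat := threshold (fun z => f z.+1 <= k) N.

Lemma step_mono i j : i <= j -> f i <= f j.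
Proof.
move=> ij; rewrite -(subnK ij); elim: (j - i) => [//|e IH].
by apply: leq_trans IH _; rewrite addSn; case/andP: (fstep (e + i)).
Qed.

Lemma step_inverseP z k : z < N -> (f z.+1 <= k) = (z < step_inverse k).
Proof.
move=> zN; apply: (thresholdP (Q := fun z => f z.+1 <= k)) zN => i j ij _.
by apply: leq_trans; apply: step_mono.
Qed.

Lemma step_inverse_lt k : k < n -> step_inverse k < N.
Proof.
move=> kn; rewrite ltnNge; apply/negP => le.
case: (posnP N) => [N0|Npos]; first by move: fN; rewrite N0 f0; lia.
by have := @step_inverseP N.-1 k; rewrite prednK // fN; lia.
Qed.

Lemma step_inverse_step k : k < n -> f (step_inverse k) <= k.
Proof.
move=> kn; have lt := step_inverse_lt kn.
case E: (step_inverse k) => [|z]; first by rewrite f0.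
by rewrite step_inverseP ?E; lia.
Qed.

Lemma step_inverse_increasing : increasing n step_inverse.
Proof.
move=> i j ij jn; have iN : i < n by lia.
rewrite -step_inverseP ?step_inverse_lt //.
by have := step_inverse_step iN; have := fstep (step_inverse i); lia.
Qed.

Lemma below_step_inverse z : z <= N -> below n step_inverse z = f z.
Proof.
move=> zN; apply: threshold_unique; first by rewrite -fN; apply: step_mono.
move=> k kn; case: z zN => [|z] zN; first by rewrite f0.
by rewrite [RHS]ltnNge step_inverseP // -leqNgt.
Qed.

End StepInverse.

(** By [linked_before] and [linked_after], the partition decides at which points [below] increases
    for the second and for the first row; induction on the gap gives both functions, and these give
    the rows. *)
Lemma link_partition_inj n N a b a' b' :
  increasing n a -> increasing n b -> increasing n a' -> increasing n b' ->
  (forall k, k < n -> a k < b k < N) -> (forall k, k < n -> a' k < b' k < N) ->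
  link_partition N (gap_height n a b) (point_depth n a b)
    = link_partition N (gap_height n a' b') (point_depth n a' b') ->
  forall k, k < n -> a k = a' k /\ b k = b' k.
Proof.
move=> ai bi ai' bi' abN abN' e.
have ab k : k < n -> a k < b k by move/abN/andP=> [].
have bN k : k < n -> b k < N by move/abN/andP=> [].
have ab' k : k < n -> a' k < b' k by move/abN'/andP=> [].
have bN' k : k < n -> b' k < N by move/abN'/andP=> [].
have L x y : x < N -> y < N ->
    linked (gap_height n a b) (point_depth n a b) x y
    = linked (gap_height n a' b') (point_depth n a' b') x y.
  move=> xN yN; have := mem_pblock_link (gap_height n a b) (point_depth n a b)
    (Ordinal xN) (Ordinal yN).
  by rewrite e mem_pblock_link /= => ->.
have Pr := tableau_profile ai bi ab bN; have Pr' := tableau_profile ai' bi' ab' bN'.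
have eb z : z <= N -> below n b z = below n b' z.
  elim: z => [|z IH] zN; first by rewrite !below0.
  have iff : (point_depth n a b z < gap_height n a b z)
      <-> (point_depth n a' b' z < gap_height n a' b' z).
    rewrite (linked_before Pr zN) (linked_before Pr' zN).
    by split=> -[y yz Lyz]; exists y => //; move: Lyz; rewrite L //; lia.
  move: iff (IH (ltnW zN)) (below_rows ai bi ab z) (below_rows ai' bi' ab' z).
  rewrite /point_depth /gap_height.
  by have := below_step z bi; have := below_step z bi'; lia.
have ea z : z <= N -> below n a z = below n a' z.
  elim: z => [|z IH] zN; first by rewrite !below0.
  have iff : (point_depth n a b z < gap_height n a b z.+1)
      <-> (point_depth n a' b' z < gap_height n a' b' z.+1).
    rewrite (linked_after Pr zN) (linked_after Pr' zN).
    by split=> -[y /andP[yz yN] Lyz]; exists y; rewrite ?yz //; move: Lyz; rewrite L.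
  move: iff (IH (ltnW zN)) (below_rows ai bi ab z) (below_rows ai' bi' ab' z).
  rewrite /point_depth /gap_height.
  by have := below_step z ai; have := below_step z ai'; lia.
have ext f g k : increasing n f -> increasing n g -> k < n -> f k < N -> g k < N ->
    (forall z, z <= N -> below n f z = below n g z) -> f k = g k.
  move=> fi gi kn fN gN efg.
  have fg z : z <= N -> (f k < z) = (g k < z).
    by move=> zN; rewrite (belowP z fi kn) (belowP z gi kn) efg.
  by have := fg (f k).+1; have := fg (g k).+1; lia.
move=> k kn; split; apply: ext => //; try exact: bN; try exact: bN'.
  by have := abN k kn; lia.
by have := abN' k kn; lia.
Qed.

(** The rows list the non-maximal and the non-minimal points, counted below [z] by [alpha] and
    [beta]; the heights are then [alpha z - beta z]. *)
Lemma noncrossing_tableau N n (pi : {set {set 'I_N}}) :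
  partition pi [set: 'I_N] -> noncrossing pi -> #|pi| + n = N ->
  exists a b, [/\ increasing n a, increasing n b,
    forall k, k < n -> a k < b k < N &
    link_partition N (gap_height n a b) (point_depth n a b) = pi].
Proof.
move=> Ppi NCpi cpi.
set H := open_height pi; set d := covering_height pi.
have Hd : profile N H d by apply: open_profile.
have [H0 HN Hs] := Hd.
pose alpha z := threshold (fun x => d x < H x.+1) z.
pose beta z := threshold (fun x => d x < H x) z.
have alphaS z : alpha z.+1 = alpha z + (d z < H z.+1) by apply: thresholdS.
have betaS z : beta z.+1 = beta z + (d z < H z) by apply: thresholdS.
have astep z : alpha z <= alpha z.+1 <= (alpha z).+1 by rewrite alphaS; lia.
have bstep z : beta z <= beta z.+1 <= (beta z).+1 by rewrite betaS; lia.
have alphaE z : z <= N -> alpha z = H z + beta z.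
  elim: z => [|z IH] zN; first by rewrite H0.
  have := IH (ltnW zN); have := Hs z zN; rewrite alphaS betaS; lia.
(* The points other than the block minima number [N - #|pi|]. *)
have betaN : beta N = n.
  have := @card_steps N beta (fun z _ => bstep z).
  move: cpi; rewrite -{1}(link_partition_open Ppi NCpi) card_link_partition //.
  rewrite -/H -/d -[X in _ = X](card_ord N).
  rewrite -(cardsC [set x : 'I_N | d x == H x]).
  have -> : ~: [set x : 'I_N | d x == H x] = [set x : 'I_N | beta x < beta x.+1].
    apply/setP => x; rewrite !inE betaS; have [Hx _] := Hs x (ltn_ord x).
    by move: (d x) (H x) Hx => u v; lia.
  by move/eqP; rewrite eqn_add2l => /eqP <-; rewrite addn0 => <-.
have alphaN : alpha N = n by rewrite alphaE // HN.
have dE z : z < N -> d z + beta z.+1 = alpha z.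
  by move=> zN; rewrite (alphaE z (ltnW zN)) betaS; have := Hs z zN; lia.
pose a := step_inverse N alpha; pose b := step_inverse N beta.
have ai : increasing n a by apply: step_inverse_increasing.
have bi : increasing n b by apply: step_inverse_increasing.
exists a, b; split=> //.
  move=> k kn; have akN : a k < N by apply: (@step_inverse_lt N n alpha).
  rewrite [b k < N](@step_inverse_lt N n beta) // andbT -step_inverseP //.
  have ak : alpha (a k) <= k by apply: (@step_inverse_step N n alpha).
  by have := dE _ akN; lia.
rewrite -[RHS](link_partition_open Ppi NCpi); apply: eq_link_partition => z zN.
  rewrite /gap_height !below_step_inverse //.
  by rewrite alphaE // addnK.
by rewrite /point_depth !below_step_inverse // 1?ltnW // -dE // addnK.
Qed.

(** * Promotion of the column heights *)

Section HeightPromotion.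
Variables (m n : nat) (u v u' v' : nat -> nat).
Hypotheses (n0 : 0 < n) (um : forall k, u k <= m) (vu : forall k, v k <= u k)
  (uanti : forall i j, i <= j -> u j <= u i)
  (vanti : forall i j, i <= j -> v j <= v i)
  (un : u' n = 0) (vn : v' n = 0)
  (u'E : forall k, k < n -> u' k = if u k <= maxn (v' k) (u' k.+1)
     then (if k is i.+1 then u i else m) else (u k).-1)
  (v'E : forall k, k < n -> v' k = if v k <= v' k.+1
     then minn (u k) (if k is i.+1 then v i else m) else (v k).-1).

Let a k := m - u k + k.
Let b k := m - v k + k.+1.
Let a' k := m - u' k + k.
Let b' k := m - v' k + k.+1.

(** Here [u] and [v] are the column heights for [h = 0] and [h = 1]. The entry [n + m] occurs
    exactly when [v n.-1 = 0]; otherwise all heights drop by 1 and all entries grow by 1. *)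
Lemma linked_height_promotion x y : x <= n + m -> y <= n + m ->
  linked (gap_height n a' b') (point_depth n a' b')
    (x.+1 %% (n + m).+1) (y.+1 %% (n + m).+1)
  = linked (gap_height n a b) (point_depth n a b) x y.
Proof.
have ai : increasing n a.
  by move=> i j ij _; rewrite /a; have := @uanti i j; have := um i; lia.
have bi : increasing n b.
  by move=> i j ij _; rewrite /b; have := @vanti i j; have := um i; have := vu i; lia.
have ab k : k < n -> a k < b k.
  by move=> _; rewrite /a /b; have := vu k; have := um k; lia.
have bM k : k < n -> b k < (n + m).+1 by rewrite /b; lia.
case: (posnP (v n.-1)) => [v0|vpos]; last first.
  have vk k : k < n -> 0 < v k.
    by move=> kn; apply: leq_trans vpos _; apply: vanti; lia.
  have ev k : k < n -> v' k = (v k).-1.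
    move: k; apply: downward_ind => k kn IH; rewrite v'E //.
    have := vk k kn; have := @vanti k k.+1 (leqnSn k).
    have [->|nk] := eqVneq k n.-1; first by rewrite prednK // vn; case: ifP; lia.
    have kn1 : k.+1 < n by lia.
    by rewrite (IH kn1); case: ifP; lia.
  have eu k : k < n -> u' k = (u k).-1.
    move: k; apply: downward_ind => k kn IH; rewrite u'E // ev //.
    have := vk k kn; have := vu k; have := @uanti k k.+1 (leqnSn k).
    have [e|nk] := eqVneq k n.-1.
      by rewrite e prednK // un; case: ifP; lia.
    have kn1 : k.+1 < n by lia.
    by rewrite (IH kn1); case: ifP; lia.
  apply: linked_promotion_singleton => //.
  - by rewrite /b; have := um n.-1; have := vu n.-1; lia.
  - by move=> k kn; rewrite /a' /a eu //; have := um k; have := vu k; have := vk k kn; lia.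
  - by move=> k kn; rewrite /b' /b ev //; have := um k; have := vu k; have := vk k kn; lia.
have [//|k0 [k0n Q0 Q0max]] := @last_index n (fun k => (k == 0) || (b k.-1 < a k)) n0.
have [//|k1 [k1n Q1 Q1max]] := @last_index n (fun k => (k == 0) || (b k.-1 <= a k)) n0.
have k01 : k0 <= k1.
  by rewrite leqNgt; apply/negP => lt; have := Q1max k0; lia.
have C0 k : k0 < k < n -> v k.-1 <= u k.
  move=> kk; have := Q0max k kk; rewrite /a /b.
  by have := um k; have := um k.-1; have := vu k.-1; lia.
have D0 : k0 = 0 \/ 0 < k0 /\ u k0 < v k0.-1.
  case: (posnP k0) => k0p; [by left|right]; split=> //.
  move: Q0; rewrite /a /b; have := um k0; have := um k0.-1; have := vu k0.-1; lia.
have C1 k : k1 < k < n -> v k.-1 < u k.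
  move=> kk; have := Q1max k kk; rewrite /a /b.
  by have := um k; have := um k.-1; have := vu k.-1; lia.
have D1 : k1 = 0 \/ 0 < k1 /\ u k1 <= v k1.-1.
  case: (posnP k1) => k1p; [by left|right]; split=> //.
  move: Q1; rewrite /a /b; have := um k1; have := um k1.-1; have := vu k1.-1; lia.
(* The slide starts in the last column, where [v] is 0, and continues left in the second row while
   [v k <= u k.+1], which by [C0] holds down to [k0]. *)
have dot k : k < n -> k0 <= k ->
    v' k = minn (u k) (if k is i.+1 then v i else m).
  move: k; apply: downward_ind => k kn IH k0k; rewrite v'E // ifT //.
  have [e|nk] := eqVneq k n.-1; first by rewrite e v0.
  have kn1 : k.+1 < n by lia.
  by rewrite (IH kn1) ?leqW //=; have := C0 k.+1; rewrite /= leq_min leqnn andbT; lia.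
have v'gt k : k < n -> k0 < k -> v' k = v k.-1.
  move=> kn kk; rewrite dot //; last lia.
  by case: k kn kk => // k kn kk; have := C0 k.+1; rewrite /=; lia.
(* At [k0] the second row receives the entry of the first row, increased by 1. *)
have v'at : v' k0 = u k0.
  rewrite dot //; case: D0 => [->|[p0 lt]]; first by have := um 0; lia.
  by case: (k0) p0 lt => // k _ /=; lia.
have v'lt k : k < n -> k < k0 -> 0 < v k /\ v' k = (v k).-1.
  move: k; apply: downward_ind => k kn IH kk.
  have vk : 0 < v k by have := @vanti k k0.-1; lia.
  split=> //; rewrite v'E // ifN // -ltnNge.
  have [e|nk] := eqVneq k.+1 k0; first by rewrite e v'at; case: D0; rewrite -?e /=; lia.
  by have [||? ->] := IH; have := @vanti k k.+1 (leqnSn k); lia.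
have u'gt k : k < n -> k1 < k -> 0 < u k /\ u' k = (u k).-1.
  move: k; apply: downward_ind => k kn IH kk.
  have lt := C1 k; split; first lia.
  rewrite u'E // ifN // -ltnNge v'gt //; last lia.
  have [e|nk] := eqVneq k.+1 n; first by rewrite e un; lia.
  by have [||? ->] := IH; have := @uanti k k.+1 (leqnSn k); lia.
(* The slide in the first row is triggered at [k1] by [u k1 <= v' k1], and further left by the new
   height of the column to the right, [u' k.+1 = u k]. *)
have u'le k : k < n -> k <= k1 -> u' k = if k is i.+1 then u i else m.
  move: k; apply: downward_ind => k kn IH kk; rewrite u'E // ifT //.
  have [e|nk] := eqVneq k k1; last by rewrite IH /=; lia.
  rewrite e leq_max; apply/orP; left; have [e'|ne] := eqVneq k0 k1.
    by rewrite -e' v'at.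
  by rewrite v'gt //; lia.
apply: (linked_promotion_arc n0 ai bi ab bM _ k01 k1n Q0 _ Q1 _) => //.
- by rewrite /b v0; lia.
- by move=> k kk; have := Q0max k kk; lia.
- by move=> k kk; have := Q1max k kk; lia.
- move=> k kn; rewrite /a'; case: (leqP k k1) => kk.
    rewrite u'le //; case: k kn kk => [|k] kn kk; first by lia.
    by rewrite /a; have := um k; lia.
  by have [? ->] := u'gt k kn kk; rewrite /a; have := um k; lia.
- move=> k kn; rewrite /b'; case: (ltngtP k k0) => kk.
  + by have [? ->] := v'lt k kn kk; rewrite /b; have := um k; have := vu k; lia.
  + rewrite v'gt // /b; have := um k.-1; have := vu k.-1; lia.
  + by rewrite kk v'at /a; have := um k0; lia.
Qed.

End HeightPromotion.

(** * Column heights of the slice and the bijection onto noncrossing partitions *)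

Section Heights.
Variables m n : nat.
Notation P := (chain_product3 2 m n).
Implicit Types I : {set P}.

Definition height I h k : nat := threshold (fun j => slice I h j k) m.

Lemma height_le I h k : height I h k <= m.
Proof. exact: threshold_le. Qed.

Lemma slice_height I h j k : order_ideal I -> slice I h j k = (j < height I h k).
Proof.
move=> Id; have [jm|mj] := ltnP j m; last first.
  have := height_le I h k; rewrite [RHS]ltnNge => le; rewrite (leq_trans le mj).
  by apply/negbTE/negP => /slice_bound[]; lia.
apply: (thresholdP (Q := fun j => slice I h j k)) jm => i j' ij _ s.
exact: slice_down s _ _ _.
Qed.

Lemma height_anti I h k h' k' : order_ideal I -> h <= h' -> k <= k' ->
  height I h' k' <= height I h k.
Proof.
move=> Id hh kk; rewrite leqNgt; apply/negP; rewrite -slice_height // => s.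
have := slice_down Id s hh (leqnn _) kk.
by rewrite slice_height // ltnn.
Qed.

Lemma height_out I h k : 1 < h \/ n <= k -> height I h k = 0.
Proof.
move=> hk; apply: threshold_unique => // j jm; rewrite ltn0.
by apply/negbTE/negP => /slice_bound[]; case: hk; lia.
Qed.

(** By [E1] the top cell of the column survives exactly when a neighbouring column [p] or [q]
    reaches it; if not, the column loses this cell. If it survives, [E2] fills the column up to the
    smaller of [r] and [s], a missing neighbour counting as a full column [m]. *)
Lemma height_rowmotion I h k : order_ideal I -> h < 2 -> k < n ->
  height (rowmotion I) h k =
  if height I h k <= maxn (height (rowmotion I) h.+1 k) (height (rowmotion I) h k.+1)
  then minn (if h is i.+1 then height I i k else m)
            (if k is i.+1 then height I h i else m)
  else (height I h k).-1.
Proof.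
move=> Id h2 kn; have Id' := rowmotion_ideal I.
set g := height I h k; set c := height (rowmotion I) h k.
set p := height (rowmotion I) h.+1 k; set q := height (rowmotion I) h k.+1.
set r := (if h is i.+1 then _ else _); set s := (if k is i.+1 then _ else _).
have gm : g <= m := height_le _ _ _; have cm : c <= m := height_le _ _ _.
have gr : g <= r <= m.
  rewrite /r; case: (h) @g {gm r} => [|i] g; rewrite ?height_le ?leqnn //.
  by rewrite height_anti.
have gs : g <= s <= m.
  rewrite /s; case: (k) @g {gm r s gr} => [|i] g; rewrite ?height_le ?leqnn //.
  by rewrite height_anti.
have E1 j : j < g -> (j < c) = [|| j < p, j.+1 < g | j < q].
  rewrite -!slice_height // => sj; exact: slice_rowmotion_in.
have E2 j : g <= j -> j < m -> (j < c) = [&& j < r, (0 < j) ==> (j.-1 < c) & j < s].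
  move=> gj jm; rewrite -!slice_height // slice_rowmotion_notin //; last first.
    by rewrite slice_height // -leqNgt.
  congr [&& _, _ & _].
  - by rewrite /r; case: (h) => [|i]; rewrite ?jm // slice_height.
  - by rewrite /s; case: (k) => [|i]; rewrite ?jm // slice_height.
case: ifP => [gpq|/negbT]; last first.
  rewrite -ltnNge gtn_max => /andP[pg qg].
  have cg : (g.-1 < c) = false by rewrite E1; clear - pg qg; lia.
  have [g1|g1] := leqP g 1; first by clear - cg g1 pg; lia.
  have : g.-2 < c by rewrite E1; clear - g1; lia.
  by clear - cg; lia.
have gc : g <= c.
  case: (posnP g) => [->//|g0]; rewrite -(prednK g0) E1; last by clear - g0; lia.
  by clear - gpq g0; lia.
have [gr' gs'] : g <= r /\ g <= s by case/andP: gr; case/andP: gs.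
apply/eqP; rewrite eqn_leq leq_min; apply/andP; split.
  have [->|ne] := eqVneq c g; first by rewrite gr' gs'.
  have : c.-1 < c by clear - gc ne; lia.
  by rewrite E2; clear - gc ne cm; lia.
have [cm'|mc] := ltnP c m; last by clear - gr mc; lia.
by move: (E2 c gc cm'); clear; lia.
Qed.

Definition entry I h k : nat := m - height I h k + (k + h).

Lemma entry_increasing I h : order_ideal I -> increasing n (entry I h).
Proof.
move=> Id i j ij _; rewrite /entry.
have := @height_anti I h i h j Id (leqnn h) (ltnW ij); have := height_le I h i; lia.
Qed.

Lemma entry_rows I k : order_ideal I -> k < n ->
  entry I 0 k < entry I 1 k < n + m + 1.
Proof.
move=> Id kn; rewrite /entry.
have := @height_anti I 0 k 1 k Id (leq0n 1) (leqnn k); have := height_le I 0 k; lia.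
Qed.

Definition noncrossing_of I : {set {set 'I_(n + m + 1)}} :=
  link_partition (n + m + 1) (gap_height n (entry I 0) (entry I 1))
    (point_depth n (entry I 0) (entry I 1)).

Lemma entry_profile I : order_ideal I -> profile (n + m + 1)
  (gap_height n (entry I 0) (entry I 1)) (point_depth n (entry I 0) (entry I 1)).
Proof.
move=> Id; apply: tableau_profile; try exact: entry_increasing;
  by move=> k kn; case/andP: (entry_rows Id kn).
Qed.

Lemma noncrossing_of_rowmotion I : 0 < n -> order_ideal I ->
  noncrossing_of (rowmotion I) = rotate_partition (noncrossing_of I).
Proof.
move=> n0 Id; apply/esym/rotate_link_partition => x y.
have Id' := rowmotion_ideal I.
have E (J : {set P}) : (forall k, entry J 0 k = m - height J 0 k + k) /\
    (forall k, entry J 1 k = m - height J 1 k + k.+1).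
  by split=> k; rewrite /entry; lia.
have [xM yM] : x <= n + m /\ y <= n + m.
  by move: (ltn_ord x) (ltn_ord y); lia.
rewrite /=; move: (nat_of_ord x) (nat_of_ord y) xM yM => {x y} x y xM yM.
rewrite addn1.
have eqL (J : {set P}) : linked (gap_height n (entry J 0) (entry J 1))
    (point_depth n (entry J 0) (entry J 1))
  =2 linked (gap_height n (fun k => m - height J 0 k + k) (fun k => m - height J 1 k + k.+1))
    (point_depth n (fun k => m - height J 0 k + k) (fun k => m - height J 1 k + k.+1)).
  move=> s t; have [e0 e1] := E J.
  apply: (linked_eq (N := (s + t).+1)); try lia;
    move=> z _; rewrite /gap_height /point_depth.
    by rewrite (eq_below _ (fun k _ => e0 k)) (eq_below _ (fun k _ => e1 k)).
  by rewrite (eq_below _ (fun k _ => e0 k)) (eq_below _ (fun k _ => e1 k)).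
rewrite !eqL; apply: linked_height_promotion => //.
- by move=> k; apply: height_le.
- by move=> k; apply: height_anti.
- by move=> i j ij; apply: height_anti.
- by move=> i j ij; apply: height_anti.
- by apply: height_out; right.
- by apply: height_out; right.
- move=> k kn; rewrite height_rowmotion // (minn_idPr _) //.
  by case: k {kn} => // k; apply: height_le.
- move=> k kn; rewrite {1}height_rowmotion // (@height_out _ 2) ?max0n //; by left.
Qed.

Lemma noncrossing_of_inj : {in order_ideals P &, injective noncrossing_of}.
Proof.
move=> I I'; rewrite !inE => Id Id' e; apply: slice_inj => // h j k h2 jm kn.
have Ee := link_partition_inj (entry_increasing 0 Id) (entry_increasing 1 Id)
  (entry_increasing 0 Id') (entry_increasing 1 Id')
  (fun k => entry_rows Id (k := k)) (fun k => entry_rows Id' (k := k)) e kn.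
rewrite !slice_height //; congr (_ < _).
have eh : entry I h k = entry I' h k by case: Ee; case: h h2 => [|[|]].
by move: eh (height_le I h k) (height_le I' h k); rewrite /entry; lia.
Qed.

(** The non-minimal points are the [n] entries of the second row, which leaves [m + 1] block
    minima. *)
Lemma noncrossing_of_mem I : order_ideal I ->
  noncrossing_of I \in noncrossing_partitions (n + m + 1) (m + 1).
Proof.
move=> Id; have Pr := entry_profile Id; rewrite inE link_partitionP.
rewrite link_partition_noncrossing //= /noncrossing_of card_link_partition //.
have bi := entry_increasing 1 Id; have ai := entry_increasing 0 Id.
have := @card_steps (n + m + 1) (below n (entry I 1)) (fun z _ => below_step z bi).
rewrite below0 addn0 below_all; last by move=> k kn; case/andP: (entry_rows Id kn).
have -> : [set x : 'I_(n + m + 1) | below n (entry I 1) x < below n (entry I 1) x.+1]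
    = ~: [set x : 'I_(n + m + 1) | point_depth n (entry I 0) (entry I 1) x
         == gap_height n (entry I 0) (entry I 1) x].
  apply/setP => x; rewrite !inE /point_depth /gap_height.
  have ab k : k < n -> entry I 0 k < entry I 1 k.
    by move=> kn; case/andP: (entry_rows Id kn).
  move: (below_rows ai bi ab x) (below_step x bi).
  by move: (below _ _ x) (below _ _ x) (below _ _ x.+1) => s t w; lia.
set S := [set x | _ == _] => cS; have := cardsC S; rewrite card_ord.
by rewrite cS; move: #|S| => c; lia.
Qed.

(** Taking slices maps the finite set of order ideals injectively into itself, hence onto itself. *)
Lemma slice_surj (K : {set P}) : order_ideal K ->
  exists2 I : {set P}, order_ideal I & forall h j k, slice I h j k = cell K h j k.
Proof.
pose S (I : {set P}) : {set P} := cells m n (slice I).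
have cS I h j k : cell (S I) h j k = slice I h j k.
  rewrite cell_cells; apply/and4P/idP => [[]//|s].
  by have [h2 jm kn] := slice_bound s; split.
have Sinj : {in order_ideals P &, injective S}.
  move=> I I'; rewrite !inE => Id Id' e; apply: slice_inj => // h j k _ _ _.
  by rewrite -!cS e.
have Ssub : S @: order_ideals P = order_ideals P.
  apply/eqP; rewrite eqEcard (card_in_imset Sinj) leqnn andbT.
  apply/subsetP => X /imsetP[I]; rewrite !inE => Id ->.
  by apply: cells_ideal => h j k h' j' k' _ _ _ hh jj kk s; apply: slice_down s _ _ _.
move=> Kd; have : K \in S @: order_ideals P by rewrite Ssub inE.
by case/imsetP=> I; rewrite inE => Id ->; exists I.
Qed.

Lemma noncrossing_of_surj pi : 0 < n ->
  pi \in noncrossing_partitions (n + m + 1) (m + 1) ->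
  exists2 I : {set P}, order_ideal I & noncrossing_of I = pi.
Proof.
move=> n0; rewrite inE => /and3P[Ppi NCpi /eqP cpi].
have [|a [b [ai bi abN <-]]] := noncrossing_tableau (n := n) Ppi NCpi.
  by rewrite cpi; lia.
(* Strict growth from [a 0 >= 0] and up to [b n.-1 <= n + m] confines the entries to the range that
   heights between 0 and [m] produce. *)
have Ba k : k < n -> k <= a k <= m + k /\ k.+1 <= b k <= m + k.+1.
  move=> kn; have [a0 _] := increasing_bounds ai kn.
  have [b0 bn] := increasing_bounds bi kn.
  by have := abN 0 n0; have := abN k kn; have := abN n.-1; lia.
pose T h := if h is 0 then a else b.
have Ti h : increasing n (T h) by case: h.
(* [T h k - (h + k)] is weakly increasing in [h] and [k], so the heights [m + (h + k) - T h k]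
   weakly decrease and bound the columns of an order ideal. *)
have Tm h h' k k' : h' <= h -> h < 2 -> k' <= k -> k < n ->
    T h' k' + (h + k) <= T h k + (h' + k').
  move=> hh h2 kk kn.
  have Tk i : T i k' + k <= T i k + k'.
    elim: k kk kn => [|k IH] kk kn; first by have -> : k' = 0 by lia.
    have [->//|nk] := eqVneq k' k.+1.
    by have := IH; have := Ti i k k.+1; lia.
  move: (Tk h) (Tk h'); have [->|nh] := eqVneq h' h; first lia.
  by have [-> ->] : h' = 0 /\ h = 1 by [lia]; rewrite /=; have := abN k kn; lia.
have [|I Id sI] := slice_surj (K := cells m n (fun h j k => j < m + (h + k) - T h k)).
  apply: cells_ideal => h j k h' j' k' h2 jm kn hh jj kk.
  by have := Tm h h' k k' hh h2 kk kn; lia.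
exists I => //.
have eT h k : h < 2 -> k < n -> entry I h k = T h k.
  move=> h2 kn.
  have B : h + k <= T h k <= m + (h + k).
    by have := Ba k kn; case: h h2 => [|[|//]] _ /=; lia.
  rewrite /entry (_ : height I h k = m + (h + k) - T h k); first lia.
  apply: threshold_unique; first lia.
  by move=> j jm; rewrite sI cell_cells h2 jm kn.
by apply: eq_link_partition => z _; rewrite /gap_height /point_depth;
  congr (_ - _); apply: eq_below => k kn; rewrite eT.
Qed.

End Heights.

Theorem theorem7p8 (m n : nat) (hm : (1 <= m)%N) (hn : (1 <= n)%N) :
  exists Phi : {set chain_product3 2 m n} -> {set {set 'I_(n + m + 1)}},
    [/\ {in order_ideals (chain_product3 2 m n) &, injective Phi},
        Phi @: order_ideals (chain_product3 2 m n)
          = noncrossing_partitions (n + m + 1) (m + 1)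
      & {in order_ideals (chain_product3 2 m n),
          forall I, Phi (rowmotion I) = rotate_partition (Phi I)}].
Proof.
exists (@noncrossing_of m n); split.
- exact: noncrossing_of_inj.
- apply/setP => pi; apply/imsetP/idP => [[I + ->]|/(noncrossing_of_surj hn)].
    by rewrite inE; apply: noncrossing_of_mem.
  by case=> I Id <-; exists I; rewrite ?inE.
- by move=> I; rewrite inE; apply: noncrossing_of_rowmotion.
Qed.
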